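(* Let $f:\mathbb{R}^n\to\mathbb{R}$ be continuously differentiable and bounded from below with $\nabla f(0)\neq 0$, let $\lambda>0$, $q\in[0,1)$, and let $x^*$ be a local minimizer of $F(x)=f(x)+\lambda\|x\|_q^q$ over $\mathbb{R}^n$. Suppose $f$ is $LC^1$ at $x^*$. Then there is an $\epsilon_*>0$ such that $x^*$ is a P-stationary point with constant $\alpha$ for every $\alpha$ with $0<\alpha<\alpha_*:=\min\{\alpha_1^*,\alpha_2^*\}$, where $$\alpha_1^*:=\frac{\epsilon_*}{2\lambda\|x^*\|_q^q+2\sqrt{\lambda^2\|x^*\|_q^{2q}+\epsilon_*\|\nabla f(x^* )\|^2}},\qquad \alpha_2^*:=\frac{1}{\sup_{x\in\mathbb{N}(x^*,\epsilon_* )}\sup_{H\in\partial^2 f(x)}\|H\|}.$$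
   Context: $\|x\|_q^q:=\sum_i|x_i|^q$, with the convention $|t|^0=1$ for $t\ne0$ and $|0|^0=0$ (so $\|x\|_0^0$ is the number of nonzero entries); $\|x\|_q^{2q}:=(\|x\|_q^q)^2$. $\|\cdot\|$ is the Euclidean norm for vectors and the spectral norm for matrices. $\mathbb{N}(x,\epsilon):=\{w\in\mathbb{R}^n:\|x-w\|^2<\epsilon\}$. The convention $1/0=+\infty$ is used. $f$ is $LC^1$ at $x$ if it is continuously differentiable and $\nabla f$ is Lipschitz continuous on some neighbourhood of $x$. Generalized Hessian: $\partial^2 f(x)$ is the convex hull of the set of all matrices $H$ for which there is a sequence $x^i\to x$ such that $f$ is twice differentiable at each $x^i$ and $\nabla^2 f(x^i)\to H$. P-stationary point: $x^*$ is a P-stationary point with constant $\alpha>0$ if $x^*\in \mathrm{Prox}_{\alpha\lambda\|\cdot\|_q^q}(x^*-\alpha\nabla f(x^* ))$, where $\mathrm{Prox}_{r}(z):=\operatorname{argmin}_{w\in\mathbb{R}^n}\frac12\|z-w\|^2+r(w)$ (the set of global minimizers). *)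

(* Defs.v *)
From HB Require Import structures.
From mathcomp Require Import all_boot all_order all_algebra.
From mathcomp Require Import all_classical all_reals all_analysis.

Set Implicit Arguments.
Unset Strict Implicit.
Unset Printing Implicit Defensive.

Import Order.TTheory GRing.Theory Num.Theory.
Import numFieldNormedType.Exports.

Local Open Scope classical_set_scope.
Local Open Scope ring_scope.

(* Points of R^n are row vectors.  The library norm `|_| on 'rV[R]_n is the
   max norm; it is used here only through the topology, continuity and
   differentiability, which agree with the Euclidean ones. *)
Definition enorm (R : realType) (n : nat) (x : 'rV[R]_n) : R :=
  Num.sqrt (\sum_i x ord0 i ^+ 2).

(* Norm of the operator v |-> v *m A on Euclidean R^n; this is also the norm of
   v |-> A *m v on column vectors, since a matrix and its transpose have the
   same operator norm. *)
Definition spectral_norm (R : realType) (n : nat) (A : 'M[R]_n) : R :=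
  sup [set enorm (v *m A) | v in [set v : 'rV[R]_n | enorm v <= 1]].

(* \|x\|_q^q.  The case split is needed because the library has 0 `^ 0 = 1. *)
Definition normqq (R : realType) (n : nat) (q : R) (x : 'rV[R]_n) : R :=
  \sum_i (if x ord0 i == 0 then 0 else `|x ord0 i| `^ q).

Definition grad (R : realType) (n : nat) (f : 'rV[R]_n -> R) (x : 'rV[R]_n) :
    'rV[R]_n :=
  \row_i 'D_(delta_mx ord0 i) f x.

Definition hessian (R : realType) (n : nat) (f : 'rV[R]_n -> R)
    (x : 'rV[R]_n) : 'M[R]_n :=
  'J (grad f) x.

Definition twice_differentiable (R : realType) (n : nat) (f : 'rV[R]_n -> R)
    (x : 'rV[R]_n) : Prop :=
  (\forall y \near x, differentiable f y) /\ differentiable (grad f) x.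

(* Only meant for open U. *)
Definition C1_on (R : realType) (n : nat) (U : set 'rV[R]_n)
    (f : 'rV[R]_n -> R) : Prop :=
  forall x, U x -> differentiable f x /\ {for x, continuous (grad f)}.

Definition LC1_at (R : realType) (n : nat) (f : 'rV[R]_n -> R)
    (x : 'rV[R]_n) : Prop :=
  exists U : set 'rV[R]_n, [/\ open_nbhs x U, C1_on U f &
    exists L : R, forall y z, U y -> U z ->
      enorm (grad f y - grad f z) <= L * enorm (y - z)].

Definition limiting_hessians (R : realType) (n : nat) (f : 'rV[R]_n -> R)
    (x : 'rV[R]_n) : set 'M[R]_n :=
  [set H | exists u : nat -> 'rV[R]_n,
    [/\ u @ \oo --> x, forall i, twice_differentiable f (u i) &
        (fun i => hessian f (u i)) @ \oo --> H]].

Definition convex_hull (R : realType) (M : lmodType R) (A : set M) : set M :=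
  smallest (@convex_set R M) A.

Definition generalized_hessian (R : realType) (n : nat) (f : 'rV[R]_n -> R)
    (x : 'rV[R]_n) : set 'M[R]_n :=
  convex_hull (limiting_hessians f x).

(* The radius eps bounds the squared distance. *)
Definition Nbd (R : realType) (n : nat) (x : 'rV[R]_n) (eps : R) :
    set 'rV[R]_n :=
  [set w | enorm (x - w) ^+ 2 < eps].

Definition prox (R : realType) (n : nat) (r : 'rV[R]_n -> R) (z : 'rV[R]_n) :
    set 'rV[R]_n :=
  [set w | forall u, 2^-1 * enorm (z - w) ^+ 2 + r w
                  <= 2^-1 * enorm (z - u) ^+ 2 + r u].

Definition P_stationary (R : realType) (n : nat) (f : 'rV[R]_n -> R)
    (lambda q alpha : R) (x : 'rV[R]_n) : Prop :=
  0 < alpha /\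
  prox (fun w => alpha * lambda * normqq q w) (x - alpha *: grad f x) x.

Definition local_minimizer (R : realType) (n : nat) (F : 'rV[R]_n -> R)
    (x : 'rV[R]_n) : Prop :=
  \forall y \near x, F x <= F y.

(* alpha1 and alpha2 are extended reals, where the library inverse satisfies
   0^-1 = +oo and (+oo)^-1 = 0. *)
Definition alpha1 (R : realType) (n : nat) (f : 'rV[R]_n -> R)
    (lambda q : R) (x : 'rV[R]_n) (eps : R) : \bar R :=
  (eps%:E / (2 * lambda * normqq q x
    + 2 * Num.sqrt (lambda ^+ 2 * normqq q x ^+ 2
                    + eps * enorm (grad f x) ^+ 2))%:E)%E.

Definition alpha2 (R : realType) (n : nat) (f : 'rV[R]_n -> R)
    (x : 'rV[R]_n) (eps : R) : \bar R :=
  (1 / ereal_sup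
    [set ereal_sup [set (spectral_norm H)%:E | H in generalized_hessian f y]
      | y in Nbd x eps])%E.

Definition alpha_star (R : realType) (n : nat) (f : 'rV[R]_n -> R)
    (lambda q : R) (x : 'rV[R]_n) (eps : R) : \bar R :=
  Order.min (alpha1 f lambda q x eps) (alpha2 f x eps).

(* Main.v *)
(* Since grad f 0 <> 0, the numbers lambda ||xs||_q^q and ||grad f(xs)|| do not
   both vanish, so alpha1 tends to 0 with eps.  Hence, if M is a Lipschitz
   constant of grad f near xs, one can choose eps so small that
   alpha < alpha1 already forces 2 alpha M <= 1, and the curvature bound
   alpha2 (hence Rademacher's theorem) is not needed.  For u near xs, local
   minimality of xs and the descent inequality
   f(u) <= f(xs) + <grad f(xs), u - xs> + M ||u - xs||^2 show that u does not
   beat xs in the proximal problem; for ||u - xs||^2 >= eps, the quadratic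
   term of the proximal objective dominates because alpha < alpha1. *)
Require Import Defs.
From HB Require Import structures.
From mathcomp Require Import all_boot all_order all_algebra.
From mathcomp Require Import all_classical all_reals all_analysis.
From mathcomp Require Import ring lra.
Import Order.TTheory GRing.Theory Num.Theory.
Import numFieldNormedType.Exports.
Local Open Scope classical_set_scope.
Local Open Scope ring_scope.

Section Euclid.
Context {R : realType} {n : nat}.
Implicit Types (x y d : 'rV[R]_n) (f : 'rV[R]_n -> R).

Definition dotr x y : R := \sum_i x ord0 i * y ord0 i.

Lemma sqr_enorm x : enorm x ^+ 2 = dotr x x.
Proof.
rewrite sqr_sqrtr; first by apply: eq_bigr => i _; rewrite expr2.
by apply: sumr_ge0 => i _; exact: sqr_ge0.
Qed.

Lemma enorm_ge0 x : 0 <= enorm x.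
Proof. exact: sqrtr_ge0. Qed.

Lemma dotrBl x y d : dotr (x - y) d = dotr x d - dotr y d.
Proof. by rewrite -sumrB; apply: eq_bigr => i _; rewrite !mxE mulrBl. Qed.

Lemma dotrNr x y : dotr x (- y) = - dotr x y.
Proof. by rewrite -sumrN; apply: eq_bigr => i _; rewrite mxE mulrN. Qed.

Lemma dotr0r x : dotr x 0 = 0.
Proof. by apply: big1 => i _; rewrite mxE mulr0. Qed.

Lemma enormZ (a : R) x : enorm (a *: x) = `|a| * enorm x.
Proof.
rewrite -sqrtr_sqr -sqrtrM ?sqr_ge0// mulr_sumr; congr Num.sqrt.
by apply: eq_bigr => i _; rewrite mxE exprMn.
Qed.

Lemma enormBC x y : enorm (x - y) = enorm (y - x).
Proof. by rewrite -opprB -scaleN1r enormZ normrN1 mul1r. Qed.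

Lemma sqr_enormDZ (a : R) x y :
  enorm (x + a *: y) ^+ 2
  = enorm x ^+ 2 + 2 * a * dotr y x + a ^+ 2 * enorm y ^+ 2.
Proof.
rewrite !sqr_enorm !mulr_sumr -!big_split.
by apply: eq_bigr => i _; rewrite !mxE/=; ring.
Qed.

(** Expand [0 <= |x - c y|^2] and divide by [2 c]. This weighted inequality replaces Cauchy-Schwarz
    below. *)
Lemma dotr_young (c : R) x y : 0 < c ->
  dotr x y <= (c^-1 * enorm x ^+ 2 + c * enorm y ^+ 2) / 2.
Proof.
move=> c0; have := sqr_ge0 (enorm (x + (- c) *: y)).
rewrite sqr_enormDZ.
have -> : dotr y x = dotr x y by apply: eq_bigr => i _; rewrite mulrC.
move=> h.
have : 0 <= c^-1 * (enorm x ^+ 2 + 2 * - c * dotr x y + (- c) ^+ 2 * enorm y ^+ 2).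
  by rewrite mulr_ge0// invr_ge0 ltW.
have -> : c^-1 * (enorm x ^+ 2 + 2 * - c * dotr x y + (- c) ^+ 2 * enorm y ^+ 2)
  = c^-1 * enorm x ^+ 2 - 2 * dotr x y + c * enorm y ^+ 2.
  by field; rewrite gt_eqF.
lra.
Qed.

(** Each squared coordinate is at most their sum, so the max norm, which defines [ball], is below
    the Euclidean norm. *)
Lemma enorm_ball x y (e : R) : 0 < e -> enorm (x - y) < e -> ball x e y.
Proof.
move=> e0 xy; split=> // i j; rewrite ord1 /ball/=.
apply: le_lt_trans xy.
rewrite -(sqrtr_sqr (x _ _ - _)) ler_wsqrtr// (bigD1 j)//= !mxE lerDl.
by apply: sumr_ge0 => k _; exact: sqr_ge0.
Qed.

Lemma enorm_gt0 x : x != 0 -> 0 < enorm x.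
Proof.
move=> x0; rewrite lt0r enorm_ge0 andbT; apply: contra x0 => /eqP x0.
have /eqP := sqr_enorm x; rewrite x0 expr0n/= eq_sym.
rewrite psumr_eq0 => [/allP h|i _]; last by rewrite -expr2 sqr_ge0.
apply/eqP/rowP => i; rewrite mxE; apply/eqP.
by have := h i (mem_index_enum _); rewrite mulf_eq0 orbb.
Qed.

Lemma derive_grad f x d : differentiable f x -> 'D_d f x = dotr (grad f x) d.
Proof.
move=> df; rewrite deriveE// [in LHS](row_sum_delta d) linear_sum.
apply: eq_bigr => i _; rewrite linearZ/= mxE deriveE//.
by rewrite mulrC.
Qed.

Lemma normqq_ge0 (q : R) x : 0 <= normqq q x.
Proof. by apply: sumr_ge0 => i _; case: ifP => // _; exact: powR_ge0. Qed.

Lemma normqq_eq0 (q : R) x : normqq q x = 0 -> x = 0.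
Proof.
move=> /eqP; rewrite psumr_eq0 => [/allP h|i _]; last first.
  by case: ifP => // _; exact: powR_ge0.
apply/rowP => i; rewrite mxE; apply/eqP/negPn/negP => xi0.
have := h i (mem_index_enum _); rewrite (negbTE xi0) powR_eq0.
by rewrite normr_eq0 (negbTE xi0).
Qed.

(** One-variable mean value theorem on [0, 1] for [phi], the restriction of [f] to a line,
    differentiated by the chain rule. *)
Lemma MVT_line f x d : (forall y, differentiable f y) ->
  exists2 c : R, 0 < c < 1 & f (x + d) - f x = dotr (grad f (x + c *: d)) d.
Proof.
move=> df.
pose phi (t : R) := f (x + t *: d).
have dphi (t : R) : is_derive t 1 phi (dotr (grad f (x + t *: d)) d).
  have dl : is_diff t (fun s : R => x + s *: d) (fun s : R => s *: d).
    have := is_diffD (is_diff_cst x t) (is_diff_scalel t d).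
    by rewrite add0r.
  have dfl := differentiableP (df (x + t *: d)).
  have dc : is_diff t phi ('d f (x + t *: d) \o (fun s : R => s *: d)).
    exact: is_diff_comp.
  apply: DeriveDef.
    by apply: diff_derivable.
  by rewrite deriveE// diff_val/= scale1r -deriveE// derive_grad.
have [c c01 e] := @MVT R phi (fun t => dotr (grad f (x + t *: d)) d) 0 1
  ltr01 (fun t _ => dphi t)
  (derivable_within_continuous (fun t _ => @ex_derive _ _ _ _ _ _ _ (dphi t))).
exists c; first by rewrite in_itv/= in c01.
by move: e; rewrite /phi scale1r scale0r addr0 subr0 mulr1.
Qed.


(* The constant is M rather than M / 2: the mean value theorem only sees the
   gradient at one intermediate point. *)
Lemma lipschitz_grad_descent f x d (M : R) : 0 < M ->
  (forall y, differentiable f y) ->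
  (forall c : R, 0 < c < 1 ->
    enorm (grad f (x + c *: d) - grad f x) <= M * enorm (c *: d)) ->
  f (x + d) <= f x + dotr (grad f x) d + M * enorm d ^+ 2.
Proof.
move=> M0 df lip; have [c c01 e] := MVT_line f x d df.
(* With weight [M] both Young terms are at most [M |d|^2], so their half-sum is too. *)
have := dotr_young M (grad f (x + c *: d) - grad f x) d M0.
rewrite dotrBl -e.
have h : enorm (grad f (x + c *: d) - grad f x) <= M * enorm d.
  apply: le_trans (lip c c01) _; rewrite ler_pM2l// enormZ.
  case/andP: c01 => c0 c1.
  by rewrite ger0_norm ?(ltW c0)// ler_piMl ?enorm_ge0// ltW.
have : M^-1 * enorm (grad f (x + c *: d) - grad f x) ^+ 2 <= M * enorm d ^+ 2.
  rewrite ler_pdivrMl// mulrA -expr2 -exprMn.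
  by rewrite ler_sqr ?nnegrE ?mulr_ge0 ?enorm_ge0// ltW.
lra.
Qed.

End Euclid.

(* The hypothesis reads [alpha < t] where [t] is the positive root, with
   rationalised numerator, of [4 G^2 t^2 + 4 a t = eps]. *)
Lemma alpha1_quadratic_bound (R : realType) (a G eps alpha : R) :
  0 <= a -> 0 < eps -> 0 < alpha ->
  alpha * (2 * a + 2 * Num.sqrt (a ^+ 2 + eps * G ^+ 2)) < eps ->
  4 * alpha * a + 4 * alpha ^+ 2 * G ^+ 2 <= eps.
Proof.
move=> a0 e0 al0; set S := Num.sqrt _ => h.
have S2 : S ^+ 2 = a ^+ 2 + eps * G ^+ 2.
  by rewrite sqr_sqrtr// addr_ge0 ?sqr_ge0// mulr_ge0 ?sqr_ge0// ltW.
have aS : a <= S.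
  rewrite -ler_sqr ?nnegrE ?sqrtr_ge0// S2 lerDl.
  by rewrite mulr_ge0 ?sqr_ge0// ltW.
(* Multiply by [eps] and factor [eps G^2 = (S - a) (S + a)]; the factor [alpha (2 a + 2 S)] is below
   [eps] by [h]. *)
have : 4 * alpha ^+ 2 * G ^+ 2 <= 2 * alpha * (S - a).
  rewrite -(ler_pM2l e0).
  have -> : eps * (4 * alpha ^+ 2 * G ^+ 2) =
      (2 * alpha * (S - a)) * (alpha * (2 * a + 2 * S)).
    have -> : eps * (4 * alpha ^+ 2 * G ^+ 2) =
      4 * alpha ^+ 2 * (S ^+ 2 - a ^+ 2) by rewrite S2; ring.
    by ring.
  rewrite mulrC; apply: ler_wpM2r (ltW h).
  by rewrite !mulr_ge0 ?subr_ge0// ltW.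
lra.
Qed.

(** Positivity of [K] rules out the value [+oo] of the extended inverse. *)
Lemma lt_alpha1 (R : realType) (n : nat) (f : 'rV[R]_n -> R)
    (lambda q : R) (x : 'rV[R]_n) (eps alpha : R) :
  let K := 2 * lambda * normqq q x
    + 2 * Num.sqrt (lambda ^+ 2 * normqq q x ^+ 2
                    + eps * enorm (grad f x) ^+ 2) in
  0 < K -> (alpha%:E < alpha1 f lambda q x eps)%E -> alpha * K < eps.
Proof.
move=> K K0; rewrite /alpha1 -/K inver (gt_eqF K0) -EFinM lte_fin.
by rewrite ltr_pdivlMr.
Qed.

Theorem theorem3p1 (R : realType) (n : nat) (f : 'rV[R]_n -> R)
  (f_C1 : C1_on setT f)
  (f_bounded_below : has_lbound (range f))
  (grad_f0 : grad f 0 != 0)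
  (lambda : R) (lambda_gt0 : 0 < lambda)
  (q : R) (q_ge0 : 0 <= q) (q_lt1 : q < 1)
  (xs : 'rV[R]_n)
  (xs_min : local_minimizer (fun x => f x + lambda * normqq q x) xs)
  (f_LC1 : LC1_at f xs) :
  exists2 eps : R, 0 < eps &
    forall alpha : R, 0 < alpha ->
      (alpha%:E < alpha_star f lambda q xs eps)%E ->
      P_stationary f lambda q alpha xs.
Proof.
have df y : differentiable f y by have [] := f_C1 y I.
have [U [/open_nbhs_nbhs Uxs _ [L0 lip0]]] := f_LC1.
pose M : R := Num.max L0 1.
have M0 : 0 < M by rewrite lt_max ltr01 orbT.
have lip y z : U y -> U z ->
    enorm (grad f y - grad f z) <= M * enorm (y - z).
  move=> Uy Uz; apply: le_trans (lip0 _ _ Uy Uz) _.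
  by rewrite ler_wpM2r ?enorm_ge0// le_max lexx.
have [r /= r0 rP] := proj1 (nbhs_ballP _ _) (filterI Uxs xs_min).
pose a : R := lambda * normqq q xs.
pose G : R := enorm (grad f xs).
have a0 : 0 <= a by rewrite mulr_ge0 ?normqq_ge0// ltW.
(* If [normqq q xs = 0] then [xs = 0], where the gradient is nonzero. *)
have aG0 : 0 < a + G.
  have [N0|N0] := eqVneq (normqq q xs) 0.
    rewrite ltr_wpDl// /G (normqq_eq0 _ _ N0); exact: enorm_gt0.
  by rewrite ltr_wpDr ?enorm_ge0// mulr_gt0// lt0r N0 normqq_ge0.
(* The bound [r] keeps [u] in the ball of [rP]; the other two give
   [delta^2 M <= delta (a + G) <= a + S], from which [2 alpha M <= 1] will follow. *)
pose delta : R := Num.min r (Num.min 1 ((a + G) / M)).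
have d0 : 0 < delta by rewrite !lt_min r0 ltr01 divr_gt0.
have dr : delta <= r by rewrite ge_min lexx.
have d1 : delta <= 1 by rewrite !ge_min lexx !orbT.
have dM : delta * M <= a + G by rewrite -ler_pdivlMr// !ge_min lexx !orbT.
pose eps := delta ^+ 2; have e0 : 0 < eps by rewrite exprn_gt0.
pose S := Num.sqrt (a ^+ 2 + eps * G ^+ 2).
have dGS : delta * G <= S.
  rewrite -[leLHS]ger0_norm ?mulr_ge0 ?enorm_ge0 ?(ltW d0)//.
  by rewrite -sqrtr_sqr ler_wsqrtr// exprMn lerDr sqr_ge0.
exists eps => // alpha al0; rewrite lt_min => /andP[al1 _].
have K0 : 0 < 2 * a + 2 * S.
  have dG : 0 <= delta * G by rewrite mulr_ge0 ?enorm_ge0// ltW.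
  have h : 0 < delta * (a + G) by rewrite mulr_gt0.
  have : delta * a <= a by rewrite ler_piMl.
  lra.
have {al1}alK : alpha * (2 * a + 2 * S) < eps.
  have := lt_alpha1 _ n f lambda q xs eps alpha.
  by rewrite /= -exprMn -mulrA => /(_ K0 al1).
have alM : 2 * alpha * M <= 1.
  have KM : 2 * eps * M <= 2 * a + 2 * S.
    have : delta * (delta * M) <= delta * (a + G) by rewrite ler_pM2l.
    have : delta * a <= a by rewrite ler_piMl.
    rewrite /eps expr2; lra.
  rewrite -(ler_pM2l e0) mulr1; apply: le_trans (ltW alK).
  have : alpha * (2 * eps * M) <= alpha * (2 * a + 2 * S) by rewrite ler_pM2l.
  lra.
split=> // u; pose d := u - xs.
have -> : xs - alpha *: grad f xs - xs = 0 + (- alpha) *: grad f xs.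
  by rewrite add0r scaleNr addrAC subrr add0r.
have -> : xs - alpha *: grad f xs - u = (xs - u) + (- alpha) *: grad f xs.
  by rewrite scaleNr addrAC.
rewrite !sqr_enormDZ.
have -> : dotr (grad f xs) (xs - u) = - dotr (grad f xs) d.
  by rewrite -dotrNr opprB.
rewrite dotr0r [enorm 0 ^+ 2]sqr_enorm dotr0r.
rewrite enormBC -/d -/G -![alpha * lambda * _]mulrA -/a.
set b := lambda * normqq q u.
have b0 : 0 <= b by rewrite mulr_ge0 ?normqq_ge0// ltW.
(* The terms [alpha^2 G^2] on both sides of the expanded inequality cancel. *)
suff : alpha * a <= 2^-1 * enorm d ^+ 2 + alpha * dotr (grad f xs) d + alpha * b.
  lra.
have [ude|ude] := ltP (enorm d) delta.
(* The whole segment is needed: intermediate points for the Lipschitz bound, the endpoint [c = 1]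
   for minimality. *)
- have line_ball (c : R) : 0 <= c <= 1 -> ball xs r (xs + c *: d).
    case/andP=> c0 c1; apply: enorm_ball => //.
    rewrite enormBC addrAC subrr add0r enormZ ger0_norm//.
    by apply: le_lt_trans (lt_le_trans ude dr); rewrite ler_piMl ?enorm_ge0.
  have Uxs0 : U xs by exact: nbhs_singleton.
  have desc : f (xs + d) <= f xs + dotr (grad f xs) d + M * enorm d ^+ 2.
    apply: lipschitz_grad_descent => // c /andP[/ltW c0 /ltW c1].
    have [Uc _] : _ /\ _ := rP _ (line_ball c (introT andP (conj c0 c1))).
    by have := lip _ _ Uc Uxs0; rewrite [xs + _]addrC addrK.
  have [_] : _ /\ _ := rP _ (line_ball 1 (introT andP (conj ler01 (lexx 1)))).
  rewrite /= scale1r -/a.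
  have -> : lambda * normqq q (xs + d) = b by rewrite addrC subrK.
  move=> mn.
  have : alpha * a <= alpha * (dotr (grad f xs) d + M * enorm d ^+ 2 + b).
    by rewrite ler_pM2l//; lra.
  have : 2 * alpha * M * enorm d ^+ 2 <= 1 * enorm d ^+ 2.
    by rewrite ler_wpM2r ?sqr_ge0.
  lra.
- have ed : eps <= enorm d ^+ 2 by rewrite ler_sqr ?nnegrE ?enorm_ge0// ltW.
  have := alpha1_quadratic_bound _ a G eps alpha a0 e0 al0 alK.
  (* This weight costs [alpha^2 G^2 + |d|^2 / 4]. The other quarter of [|d|^2 / 2] is at least
     [eps / 4], which covers [alpha a + alpha^2 G^2] by the quadratic bound. *)
  have := dotr_young (2 * alpha)^-1 (grad f xs) (- d).
  rewrite invr_gt0 mulr_gt0// => /(_ isT).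
  rewrite dotrNr -[- d]sub0r enormBC subr0 invrK -/G -(ler_pM2l al0).
  have -> : alpha * ((2 * alpha * G ^+ 2 + (2 * alpha)^-1 * enorm d ^+ 2) / 2)
     = alpha ^+ 2 * G ^+ 2 + enorm d ^+ 2 / 4.
    by field; rewrite gt_eqF.
  have : 0 <= alpha * b by rewrite mulr_ge0// ltW.
  lra.
Qed.
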